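(* Let $L$ be a finite geometric modular lattice with height function $h$, induced metric $d_h$, and greatest element $I$. Let $C\subseteq L$ be a lattice scheme with minimum distance $d$, and let $C$ be punctured by a dimension to $C'$, i.e. $C'=\{w\wedge a \mid a\in C\}$ for some $w\in L$ with $h(w)=h(I)-1$. Let $d_{\min}(C')$ denote the minimum distance of $C'$. Then: 1. If $L$ is distributive, then $d_{\min}(C')\ge d-1$. 2. In general (without assuming distributivity), $d_{\min}(C')\ge d-2$.
   Context: All lattices are finite, with greatest element $I$ and least element $O$. The height $h(x)$ of $x\in L$ is the maximum length $l$ of a chain $O=x_0<x_1<\cdots<x_l=x$ (so $h(O)=0$). A lattice is modular if $a\le c$ implies $a\vee(b\wedge c)=(a\vee b)\wedge c$. An atom is an element of height 1. A geometric modular lattice is a modular lattice of finite height in which every element is a join of atoms. In a modular lattice, $d_h(a,b):=h(a\vee b)-h(a\wedge b)$ is a metric on $L$. A lattice scheme in $(L,d_h)$ is a subset $C\subseteq L$; its minimum distance is $\min\{d_h(a,b): a,b\in C,\ a\ne b\}$, which is defined when $C$ has at least two elements. If $C'$ has only one element, the inequalities on $d_{\min}(C')$ are regarded as vacuous. *)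

(* Defs.v *)
From HB Require Import structures.
From mathcomp Require Import all_boot all_order.

Set Implicit Arguments.
Unset Strict Implicit.
Unset Printing Implicit Defensive.

Import Order.TTheory.
Local Open Scope order_scope.

Section LatticeScheme.
Context {disp : Order.disp_t} {L : finTBLatticeType disp}.
Implicit Types (x a b c w : L) (C : {set L}).

(* A chain \bot = x_0 < x_1 < ... < x_l = x is given by the l-tuple
   (x_1, ..., x_l); its l + 1 entries are distinct, so l < #|L|. *)
Definition height x : nat :=
  \max_(l < #|L| | [exists t : l.-tuple L,
                      path <%O \bot t && (last \bot t == x)]) l.

Definition modular : Prop :=
  forall a b c, a <= c -> a `|` (b `&` c) = (a `|` b) `&` c.

Definition distributive : Prop :=
  left_distributive (@Order.meet disp L) (@Order.join disp L).

Definition atom a : bool := height a == 1%N.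

Definition geometric : Prop :=
  forall x, exists2 A : {set L}, {in A, forall a, atom a} &
    x = \join_(a in A) a.

(* The subtraction never truncates, since height is monotone. *)
Definition dist a b : nat := (height (a `|` b) - height (a `&` b))%N.

(* A relation rather than a function: no d is a minimum distance of a set with
   fewer than two elements. *)
Definition min_distance C (d : nat) : Prop :=
  (exists a b, [/\ a \in C, b \in C, a != b & dist a b = d]) /\
  (forall a b, a \in C -> b \in C -> a != b -> (d <= dist a b)%N).

Definition puncture w C : {set L} := [set w `&` a | a in C].

End LatticeScheme.

Arguments modular {disp} L.
Arguments distributive {disp} L.
Arguments geometric {disp} L.

(* Main.v *)
(* In a modular lattice the transposed intervals [a `&` b, a] and [b, a `|` b]
   have the same covering pairs.  By induction this makes the height grow by
   exactly 1 along a covering pair, and then makes it a valuation: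
   h (a `|` b) + h (a `&` b) = h a + h b.  Hence meeting with a coatom w lowers
   the height of any element by at most 1.  As h (w `&` a `&` b) <= h (a `&` b),
   the distance of a and b drops by at most the loss in h (a `|` b) when L is
   distributive, since then w `&` (a `|` b) is the join of the punctured
   elements; in general dist a b = h a + h b - 2 h (a `&` b), and it drops by at
   most the sum of the losses in h a and h b. *)
Require Import Defs.
From HB Require Import structures.
From mathcomp Require Import all_boot all_order zify.

Set Implicit Arguments.
Unset Strict Implicit.
Unset Printing Implicit Defensive.

Import Order.TTheory.
Local Open Scope order_scope.

Section Height.
Context {disp : Order.disp_t} {L : finTBLatticeType disp}.
Implicit Types (x y z a b c w : L) (s : seq L).

Lemma path_size_height s x :
  path <%O \bot s -> last \bot s = x -> (size s <= height x)%N.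
Proof.
move=> ps lx.
have us : uniq (\bot :: s) by apply: (sorted_uniq lt_trans ltxx).
have szs : (size s < #|L|)%N.
  by have := max_card (mem (\bot :: s)); rewrite (card_uniqP us).
apply: (@leq_bigmax_cond _ _ (fun l : 'I_#|L| => l : nat) (Ordinal szs)).
by apply/existsP; exists (in_tuple s); rewrite ps lx eqxx.
Qed.

Lemma height_path x : x != \bot ->
  exists s, [/\ path <%O \bot s, last \bot s = x & size s = height x].
Proof.
move=> x0; rewrite /height.
pose P (l : 'I_#|L|) :=
  [exists t : l.-tuple L, path <%O \bot t && (last \bot t == x)].
have P1 : (0 < #|P|)%N.
  have szx : (1 < #|L|)%N.
    have /card_uniqP/= <- : uniq [:: x; \bot] by rewrite /= inE x0.
    exact: max_card.
  apply/card_gt0P; exists (Ordinal szx); apply/existsP.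
  (* The one-step chain from [\bot] to [x] shows that the maximum ranges over a nonempty set, hence
     is attained. *)
  by exists [tuple x]; rewrite /= lt0x x0 eqxx.
have [l /existsP[t /andP[pt /eqP lt]] ->] := eq_bigmax_cond (@nat_of_ord _) P1.
by exists t; rewrite size_tuple.
Qed.

Lemma height_bot : height (\bot : L) = 0%N.
Proof.
apply/eqP; rewrite -leqn0; apply/bigmax_leqP => l /existsP[t /andP[]].
case/lastP: (tval t) (size_tuple t) => [|s y] st; first by rewrite -st.
rewrite last_rcons rcons_path => /andP[_ ltl] /eqP y0.
by move: ltl; rewrite y0 ltx0.
Qed.

Lemma height_lt x y : x < y -> (height x < height y)%N.
Proof.
move=> xy; have [->|x0] := eqVneq x \bot.
  rewrite height_bot; apply: (@path_size_height [:: y]) => //=.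
  by rewrite (le_lt_trans _ xy) ?le0x.
have [s [ps lx <-]] := height_path x0.
rewrite -(size_rcons s y); apply: path_size_height; last exact: last_rcons.
by rewrite rcons_path ps lx.
Qed.

Lemma height_le x y : x <= y -> (height x <= height y)%N.
Proof. by rewrite le_eqVlt => /predU1P[->//|/height_lt/ltnW]. Qed.

(** Take for [z] the last element but one of a longest chain up to [x]. *)
Lemma height_pred x : x != \bot -> exists2 z, z < x & (height z).+1 = height x.
Proof.
move=> x0; have [s [ps lx sx]] := height_path x0.
case/lastP: s ps lx sx => [_ /= bx|s y]; first by rewrite -bx eqxx in x0.
rewrite rcons_path last_rcons size_rcons => /andP[ps ltl] yx; subst y => sx.
exists (last \bot s) => //; apply/eqP; rewrite eqn_leq height_lt //= -sx ltnS.
exact: path_size_height.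
Qed.

Definition covers x y : Prop := x < y /\ forall z, x < z -> z <= y -> z = y.

Lemma height_covers x y : x < y -> (height x).+1 = height y -> covers x y.
Proof.
move=> xy hxy; split=> // z xz; rewrite le_eqVlt => /predU1P[//|zy].
by move: (height_lt xz) (height_lt zy); lia.
Qed.

(** An element of greatest height in the half-open interval from [x] to [y] works. *)
Lemma covers_above x y : x < y -> exists2 z, x <= z & covers z y.
Proof.
move=> xy; have Px : (x <= x) && (x < y) by rewrite lexx.
case: (arg_maxnP (P := fun z => (x <= z) && (z < y)) height Px).
move=> z /andP[xz zy] zmax; exists z => //; split=> // u zu.
rewrite le_eqVlt => /predU1P[//|uy].
have := zmax u; rewrite uy (le_trans xz (ltW zu)) => /(_ isT).
by move: (height_lt zu); lia.
Qed.

Lemma covers_join x y z : covers x z -> covers y z -> x != y -> x `|` y = z.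
Proof.
move=> [xz xcov] [yz ycov] xy.
have le_z : x `|` y <= z by rewrite leUx !ltW.
have := leUl x y; rewrite le_eqVlt => /predU1P[xE|/xcov]; last exact.
have := leUr y x; rewrite le_eqVlt => /predU1P[yE|/ycov]; last exact.
by case/eqP: xy; rewrite xE -yE.
Qed.

Hypothesis hmod : modular L.

Lemma covers_meet_join a b : covers (a `&` b) a -> covers b (a `|` b).
Proof.
move=> [ltab cov]; split=> [|z bz zab].
  rewrite lt_neqAle leUr andbT; apply: contraTneq ltab => bE.
  by rewrite (meet_l (y := b)) ?ltxx // bE leUl.
(* If [z] meets [a] no higher than [b] does, the modular law collapses [z] to [b]; otherwise
   covering forces [a <= z]. *)
have := leI2 (lexx a) (ltW bz); rewrite le_eqVlt => /predU1P[abE|lt_az].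
  suff zb : z = b by rewrite zb ltxx in bz.
  by rewrite -(meet_r zab) joinC -hmod ?(ltW bz) // -abE join_l ?leIr.
apply/le_anti; rewrite zab leUx (ltW bz) andbT /=.
by rewrite -(cov _ lt_az) ?leIl // leIr.
Qed.

Lemma covers_join_meet a b : covers b (a `|` b) -> covers (a `&` b) a.
Proof.
move=> [ltb cov]; split=> [|z abz za].
  rewrite lt_neqAle leIl andbT; apply: contraTneq ltb => abE.
  by rewrite (join_r (x := a)) ?ltxx // -abE leIr.
have ltbz : b < z `|` b.
  rewrite lt_neqAle leUr andbT; apply: contraTneq abz => bE.
  by rewrite le_gtF // lexI za bE leUl.
have zbE := cov _ ltbz (leU2 za (lexx b)).
(* As [z] and [a] have the same join with [b], the modular law for [z <= a] identifies them. *)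
have := hmod b za; rewrite zbE (meet_r (leUl a b)) => <-.
by rewrite join_l // meetC ltW.
Qed.

(** Compare [x] with a lower cover [z] of [y] on a longest chain: both cover their meet, so by
    induction they have equal height. *)
Lemma covers_height x y : covers x y -> (height x).+1 = height y.
Proof.
have [n] := ubnP (height y); elim: n x y => // n IHn x y; rewrite ltnS => hy xy.
have y0 : y != \bot by rewrite -lt0x (le_lt_trans (le0x x) xy.1).
have [z zy hz] := height_pred y0; have yz := height_covers zy hz.
have [->//|nxz] := eqVneq x z.
have xzE := covers_join xy yz nxz.
have hx := height_lt xy.1.
have cx : covers (x `&` z) x by apply: covers_join_meet; rewrite xzE.
have cz : covers (x `&` z) z.
  by rewrite meetC; apply: covers_join_meet; rewrite joinC xzE.
by rewrite -hz -(IHn _ _ _ cx) -1?(IHn _ _ _ cz) //; lia.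
Qed.

(** Induction replaces [a] by a lower cover [c] lying above the meet of [a] and [b]: the meet with
    [b] is unchanged, while [a] and the join with [b] each lose one in height. *)
Lemma height_valuation a b :
  (height (a `|` b) + height (a `&` b) = height a + height b)%N.
Proof.
have [n] := ubnP (height a); elim: n a => // n IHn a; rewrite ltnS => ha.
have := leIl a b; rewrite le_eqVlt => /predU1P[abE|ltab].
  have ab : a <= b by rewrite -abE leIr.
  by rewrite abE join_r // addnC.
have [c abc ca] := covers_above ltab; have hc := covers_height ca.
have cbE : c `&` b = a `&` b.
  by apply/le_anti; rewrite !lexI !leIr abc (le_trans (leIl c b)) // ltW // ca.1.
(* This puts the cover of [c] by [a] in the form transposed by [covers_meet_join]. *)
have acbE : a `&` (c `|` b) = c.
  by rewrite meetC -hmod ?(ltW ca.1) // join_l // meetC.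
have /covers_meet_join : covers (a `&` (c `|` b)) a by rewrite acbE.
rewrite joinA (join_l (ltW ca.1)) => /covers_height hab.
have lt_cn : (height c < n)%N by lia.
by move: (IHn c lt_cn); rewrite cbE; lia.
Qed.

Lemma height_meet_coatom w x :
  (height w).+1 = height (\top : L) -> (height x <= (height (w `&` x)).+1)%N.
Proof.
have le1 : (height (w `|` x) <= height (\top : L))%N by rewrite height_le ?lex1.
by move: (height_valuation w x); lia.
Qed.

Lemma dist_puncture w a b : (height w).+1 = height (\top : L) ->
  (dist a b - 2 <= dist (w `&` a) (w `&` b))%N.
Proof.
move=> hw; rewrite /dist.
have wab : w `&` a `&` (w `&` b) <= a `&` b by rewrite leI2 ?leIr.
move: (height_le wab) (height_valuation a b).
move: (height_valuation (w `&` a) (w `&` b)).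
by move: (height_meet_coatom a hw) (height_meet_coatom b hw); lia.
Qed.

Lemma dist_puncture_distributive w a b :
    distributive L -> (height w).+1 = height (\top : L) ->
  (dist a b - 1 <= dist (w `&` a) (w `&` b))%N.
Proof.
move=> hdist hw; rewrite /dist.
have wab : w `&` a `&` (w `&` b) <= a `&` b by rewrite leI2 ?leIr.
have -> : (w `&` a) `|` (w `&` b) = w `&` (a `|` b).
  by rewrite ![w `&` _]meetC hdist.
by move: (height_le wab) (height_meet_coatom (a `|` b) hw); lia.
Qed.

End Height.

Local Close Scope order_scope.

Theorem lemma1 (disp : Order.disp_t) (L : finTBLatticeType disp)
    (hmod : modular L) (hgeo : geometric L)
    (C : {set L}) (d : nat) (hd : min_distance C d)
    (w : L) (hw : (height w).+1 = height (\top%O : L))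
    (d' : nat) (hd' : min_distance (puncture w C) d') :
  (distributive L -> d - 1 <= d') /\ d - 2 <= d'.
Proof.
case: hd' => -[_ [_ [/imsetP[a aC ->] /imsetP[b bC ->] nab <-]]] _.
(* [d'] is attained at two distinct punctured elements, whose preimages [a] and [b] must then
   differ. *)
have dab : d <= dist a b by apply: hd.2 => //; apply: contraNneq nab => ->.
split=> [hdist|]; last exact: leq_trans (leq_sub2r _ dab) (dist_puncture _ _ _ _).
exact: leq_trans (leq_sub2r _ dab) (dist_puncture_distributive _ _ _ _ _).
Qed.
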